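(* Let $\{\widetilde\mu_n\}_{n\ge 0}$ (real-valued) and $\{\widetilde\sigma_n\}_{n\ge 0}$ (positive) be arbitrary sequences of point estimators adapted to the canonical filtration $\{\mathcal F_n\}_{n\ge 0}$. Then the process $R_0^-=1$, $$R_n^-=\left(\overline{X_n^2}-(\widehat\mu_n\wedge0)^2\right)^{n/2}\mathrm e^{n/2}\prod_{i=1}^n\frac1{\widetilde\sigma_{i-1}}\exp\left\{-\frac12\left(\frac{X_i-\widetilde\mu_{i-1}}{\widetilde\sigma_{i-1}}\right)^2\right\}\qquad(n\ge1)$$ is an e-process for $\mathcal N_{\mu\le0}=\{N(\mu,\sigma^2):\mu\le0,\sigma>0\}$ on $\{\mathcal F_n\}$.
   Context: $X_1,X_2,\dots$ are real observations; $\mathcal F_n=\sigma(X_1,\dots,X_n)$, with $\mathcal F_0$ trivial. $\widehat\mu_n=\frac1n\sum_{i=1}^nX_i$ and $\overline{X_n^2}=\frac1n\sum_{i=1}^nX_i^2$; $a\wedge b=\min(a,b)$. $N(\mu,\sigma^2)$ is the normal law with mean $\mu$ and variance $\sigma^2$. ''Adapted'' means $\widetilde\mu_n,\widetilde\sigma_n$ are $\mathcal F_n$-measurable. For a class $\mathcal P$ of distributions on $\mathbb R$, a $[0,\infty]$-valued process $\{M_n\}$ adapted to a filtration $\{\mathcal G_n\}$ is an e-process for $\mathcal P$ on $\{\mathcal G_n\}$ if for every $\{\mathcal G_n\}$-stopping time $\tau$ and every $P\in\mathcal P$, $\mathbb E[M_\tau]\le1$ when $X_1,X_2,\dots$ are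 i.i.d. from $P$ (with $M_\infty:=\limsup_nM_n$ on $\{\tau=\infty\}$). *)

(* Defs.v *)
From HB Require Import structures.
From mathcomp Require Import all_boot all_order all_algebra finmap.
From mathcomp Require Import all_classical all_reals all_analysis.
From mathcomp Require Import measurable_realfun.

Set Implicit Arguments.
Unset Strict Implicit.
Unset Printing Implicit Defensive.

Import Order.TTheory GRing.Theory Num.Theory.
Import numFieldNormedType.Exports.

Local Open Scope classical_set_scope.
Local Open Scope ring_scope.

(* Observations are indexed from 0: [X i] is the (i+1)-st observation. *)

Section observations.
Context (d : measure_display) (T : measurableType d) (R : realType).
Implicit Types (X : nat -> {mfun T >-> R}) (P : probability T R).

Definition mutually_independent P X : Prop :=
  forall (J : {fset nat}) (B : nat -> set R),
    (forall i, i \in J -> measurable (B i)) ->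
    P (\bigcap_(i in [set` J]) (X i @^-1` B i)) =
    (\prod_(i <- J) P (X i @^-1` B i))%E.

Definition iid_from (Q : probability R R) P X : Prop :=
  mutually_independent P X /\
  forall i (B : set R), measurable B -> distribution P (X i) B = Q B.

(* sigma(X 0, ..., X n.-1), the information of the first n observations *)
Definition canonical_filtration X (n : nat) : set (set T) :=
  g_sigma_preimage (fun i : 'I_n => X i : T -> R).

End observations.

Section processes.
Context (d : measure_display) (T : measurableType d) (R : realType).
Implicit Types (G : nat -> set (set T)) (tau : T -> option nat).
Implicit Types (M : nat -> T -> \bar R).

Definition is_filtration G : Prop :=
  [/\ forall n, sigma_algebra setT (G n),
      forall n, G n `<=` measurable &
      forall m n, (m <= n)%N -> G m `<=` G n].

Definition adapted (d' : measure_display) (U : measurableType d')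
    G (Y : nat -> T -> U) : Prop :=
  forall n (B : set U), measurable B -> G n (Y n @^-1` B).

(* The value None stands for an infinite time. *)
Definition stopping_time G tau : Prop :=
  forall n, G n [set w | exists2 k, tau w = Some k & (k <= n)%N].

Definition stopped M tau (w : T) : \bar R :=
  if tau w is Some n then M n w else limn_esup (fun n => M n w).

Definition is_eprocess (X : nat -> {mfun T >-> R}) (PP : set (probability R R))
    G M : Prop :=
  [/\ is_filtration G, adapted G M, forall n w, (0 <= M n w)%E &
      forall tau, stopping_time G tau ->
      forall Q, PP Q ->
      forall P : probability T R, iid_from Q P X ->
        (\int[P]_w stopped M tau w <= 1)%E].

End processes.

Section one_sided_normal.
Context (R : realType).

(* [normal_prob mu sigma] takes the standard deviation, not the variance. *)
Definition normal_nonpos_mean : set (probability R R) :=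
  [set Q | exists mu sigma : R,
    [/\ mu <= 0, 0 < sigma &
        forall B : set R, measurable B -> Q B = normal_prob mu sigma B]].

Context (d : measure_display) (T : measurableType d).
Implicit Types (X : nat -> {mfun T >-> R}) (mu sigma : nat -> T -> R).

Definition sample_mean X (n : nat) (w : T) : R :=
  n%:R^-1 * \sum_(i < n) X i w.

Definition sample_mean_sq X (n : nat) (w : T) : R :=
  n%:R^-1 * \sum_(i < n) X i w ^+ 2.

Definition Rminus X mu sigma (n : nat) (w : T) : R :=
  if n is 0 then 1 else
  (sample_mean_sq X n w - Num.min (sample_mean X n w) 0 ^+ 2) `^ (n%:R / 2) *
  expR (n%:R / 2) *
  \prod_(i < n) ((sigma i w)^-1 *
    expR (- 2^-1 * ((X i w - mu i w) / sigma i w) ^+ 2)).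

End one_sided_normal.

(* Main.v *)
(**
Fix m <= 0 and s > 0.  Maximising the normal likelihood over the null
hypothesis shows that R_n^- is at most the likelihood ratio
M_n = \prod_(i < n) g_i, where g_i is the ratio at X_i of the densities of
N(mu_i, sigma_i^2) and N(m, s^2).  Since X_i is independent of the past and
mu_i, sigma_i are functions of the past, Fubini's theorem shows that every
wealth process obtained from M by betting, at each time, either on the factor
g_i or on 1 according to the past has expectation at most 1.  Betting until a
stopping time tau gives the stopped process; betting on the upcrossings of an
interval gives Dubins' inequality, so that M converges almost surely.  Hence
the limsup defining the value at tau = oo is almost surely a liminf, and Fatou's
lemma concludes.
*)
Require Import Defs.
From HB Require Import structures.
From mathcomp Require Import all_boot all_order all_algebra finmap.
From mathcomp Require Import all_classical all_reals all_analysis.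
From mathcomp Require Import measurable_realfun ring lra.

Set Implicit Arguments.
Unset Strict Implicit.
Unset Printing Implicit Defensive.

Import Order.TTheory GRing.Theory Num.Theory.
Import numFieldNormedType.Exports.

Local Open Scope classical_set_scope.
Local Open Scope ring_scope.

(** * Maximum of the normal likelihood over nonpositive means *)

Section normal_likelihood.
Context (R : realType).
Implicit Types (x : nat -> R) (m s V : R).

(** With [y = V / s ^+ 2] and [s ^+ n] cancelled, this is [y <= expR (y - 1)] raised to the power
    [n%:R / 2]. Equality holds at [s ^+ 2 = V], the maximum-likelihood variance. *)
Lemma profile_le s V (n : nat) : 0 < s -> 0 <= V ->
  V `^ (n%:R / 2) * expR (n%:R / 2) <= s ^+ n * expR (n%:R * V / (2 * s ^+ 2)).
Proof.
move=> s0 V0; have s20 : 0 < s ^+ 2 by exact: exprn_gt0.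
pose y := V / s ^+ 2.
have Vy : V = s ^+ 2 * y by rewrite /y mulrCA divff ?mulr1// gt_eqF.
have y0 : 0 <= y by rewrite /y divr_ge0// ltW.
have yle : y <= expR (y - 1).
  by have := expR_ge1Dx (y - 1); rewrite addrCA subrr addr0.
have -> : s ^+ n = (s ^+ 2) `^ (n%:R / 2).
  rewrite -(powR_mulrn n (ltW s0)) -(powR_mulrn 2 (ltW s0)) -powRrM mulrCA.
  by rewrite divff ?mulr1 ?pnatr_eq0.
rewrite Vy powRM ?(ltW s20)// -mulrA.
apply: ler_wpM2l; first exact: powR_ge0.
have -> : n%:R * (s ^+ 2 * y) / (2 * s ^+ 2) = (y - 1) * (n%:R / 2) + n%:R / 2 :> R.
  by field; rewrite gt_eqF.
rewrite expRD expRM; apply: ler_wpM2r; first exact: expR_ge0.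
by apply: ge0_ler_powR => //; rewrite nnegrE expR_ge0.
Qed.

(** [n%:R * V] is the sum of squared deviations about [Num.min a 0], the nonpositive number closest
    to the sample mean [a]. If [a <= 0], the excess at [m] is [n%:R * (a - m) ^+ 2]; otherwise it is
    [n%:R * (m ^+ 2 - 2 * m * a)], nonnegative because [m <= 0 < a]. *)
Lemma profile_variance_le x m (n : nat) : m <= 0 -> (0 < n)%N ->
  let V := n%:R^-1 * (\sum_(i < n) x i ^+ 2) -
           Num.min (n%:R^-1 * \sum_(i < n) x i) 0 ^+ 2 in
  0 <= V /\ n%:R * V <= \sum_(i < n) (x i - m) ^+ 2.
Proof.
move=> m0 n0 V.
have nR : 0 < n%:R :> R by rewrite ltr0n.
set S1 := \sum_(i < n) x i in V *; set S2 := \sum_(i < n) x i ^+ 2 in V *.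
have E c : \sum_(i < n) (x i - c) ^+ 2 = S2 - 2 * c * S1 + n%:R * c ^+ 2.
  rewrite (eq_bigr (fun i : 'I_n => x i ^+ 2 - 2 * c * x i + c ^+ 2)); last first.
    by move=> i _; ring.
  by rewrite big_split/= sumrB -mulr_sumr sumr_const card_ord -(mulr_natl (c ^+ 2)).
have S20 : 0 <= S2 by apply: sumr_ge0 => i _; exact: sqr_ge0.
set a := n%:R^-1 * S1 in V *.
have S1E : S1 = n%:R * a by rewrite /a mulrA mulfV ?mul1r// gt_eqF.
have VE c : n%:R * (n%:R^-1 * S2 - c) = S2 - n%:R * c.
  by rewrite mulrBr mulrA mulfV ?mul1r// gt_eqF.
split.
  rewrite -(pmulr_rge0 _ nR) VE.
  have [a0|a0] := leP a 0; last by rewrite expr0n/= mulr0 subr0.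
  have : 0 <= \sum_(i < n) (x i - a) ^+ 2 by apply: sumr_ge0 => i _; exact: sqr_ge0.
  by rewrite E S1E; congr (_ <= _); ring.
rewrite VE E S1E.
have [a0|a0] := leP a 0.
  rewrite -subr_ge0 (_ : _ - _ = n%:R * (a - m) ^+ 2); last by ring.
  by rewrite mulr_ge0 ?sqr_ge0// ltW.
rewrite expr0n/= mulr0 subr0 -addrA lerDl.
have : 0 <= - (m * (n%:R * a)).
  by rewrite -mulNr mulr_ge0 ?oppr_ge0// mulr_ge0// ltW.
have : 0 <= n%:R * m ^+ 2 by rewrite mulr_ge0 ?sqr_ge0// ltW.
lra.
Qed.

End normal_likelihood.

(** * Integration against a measure with a density *)

Section integral_density.
Local Open Scope ereal_scope.
Context (d : measure_display) (T : measurableType d) (R : realType).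
Variables (mu nu : {measure set T -> \bar R}) (p : T -> R).
Hypotheses (mp : measurable_fun setT p) (p0 : forall x, (0 <= p x)%R).
Hypothesis nuE : forall B, measurable B -> nu B = \int[mu]_(x in B) (p x)%:E.

Import HBNNSimple.

Let integral_density_nnsfun (f : {nnsfun T >-> R}) :
  \int[nu]_x (f x)%:E = \int[mu]_x ((f x)%:E * (p x)%:E).
Proof.
under [LHS]eq_integral do rewrite fimfunE -fsumEFin//.
rewrite [LHS]ge0_integral_fsum//; last 2 first.
  - by move=> r; exact/measurable_EFinP/measurableT_comp.
  - by move=> n x _; rewrite EFinM nnfun_muleindic_ge0.
under [RHS]eq_integral.
  move=> x xD; rewrite fimfunE -fsumEFin// ge0_mule_fsuml; last first.
    by move=> r; rewrite EFinM nnfun_muleindic_ge0.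
  over.
have mpf r : measurable_fun setT
    (fun x => (\1_(f @^-1` [set r]) x)%:E * (p x)%:E).
  by apply: emeasurable_funM; exact/measurable_EFinP.
rewrite [RHS]ge0_integral_fsum//; last 2 first.
  - move=> r; apply: emeasurable_funM; apply/measurable_EFinP => //.
    exact: measurableT_comp.
  - move=> r x _; apply: mule_ge0; last by rewrite lee_fin.
    by rewrite EFinM nnfun_muleindic_ge0.
apply: eq_fsbigr => r /[!inE] -[x _ fxr].
have r0 : (0 <= r)%R by rewrite -fxr.
under [RHS]eq_integral do rewrite EFinM -muleA.
rewrite [RHS]ge0_integralZl ?lee_fin//; last first.
  by move=> y _; rewrite mule_ge0// lee_fin.
rewrite [LHS]integralZl_indic_nnsfun//; congr (_ * _).
rewrite integral_indic// setIT nuE//.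
rewrite integral_mkcond; apply: eq_integral => y _.
by rewrite patchE indicE; case: ifPn; rewrite ?mul1e ?mul0e.
Qed.

(** Monotone convergence extends the identity from simple functions, for which it is [nuE] on the
    level sets. *)
Lemma ge0_integral_density (f : T -> \bar R) : measurable_fun setT f ->
  (forall x, 0 <= f x) -> \int[nu]_x f x = \int[mu]_x (f x * (p x)%:E).
Proof.
move=> mf f0; pose f_ := nnsfun_approx measurableT mf.
have f_nd x m n : (m <= n)%N -> (f_ m x)%:E <= (f_ n x)%:E.
  by move=> mn; rewrite lee_fin; exact/lefP/nd_nnsfun_approx.
have f_cvg x : (f_ n x)%:E @[n --> \oo] --> f x by exact: cvg_nnsfun_approx.
transitivity (limn (fun n => \int[nu]_x (f_ n x)%:E)).
  rewrite -monotone_convergence//=.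
  - by apply: eq_integral => x _; exact/esym/cvg_lim.
  - by move=> n; exact/measurable_EFinP.
  - by move=> n x _; rewrite lee_fin.
  - by move=> x _ m n; exact: f_nd.
transitivity (limn (fun n => \int[mu]_x ((f_ n x)%:E * (p x)%:E))).
  by apply: congr_lim; apply/funext => n; exact: integral_density_nnsfun.
rewrite -monotone_convergence//=.
- apply: eq_integral => x _; apply/cvg_lim => //.
  by apply: cvgeZr => //; exact: f_cvg.
- by move=> n; apply: emeasurable_funM; exact/measurable_EFinP.
- by move=> n x _; rewrite mule_ge0// lee_fin.
- by move=> x _ m n mn; rewrite lee_wpmul2r ?lee_fin// -lee_fin; exact: f_nd.
Qed.

End integral_density.

(** * Independence of an observation from the past *)

Section past_independence.
Context (d : measure_display) (T : measurableType d) (R : realType).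
Variables (P : probability T R) (X : nat -> {mfun T >-> R}).

(** Unlike preimages under a single observation, these sets are stable under intersection, as
    Dynkin's theorem requires, and they still generate the past. *)
Let cylinder (n : nat) : set (set T) :=
  [set C | exists2 B : nat -> set R, (forall i, measurable (B i)) &
    C = \bigcap_(i in `I_n) (X i @^-1` B i)].

Lemma canonical_filtrationE n : canonical_filtration X n =
  <<s \bigcup_(i in `I_n) preimage_set_system setT (X i) measurable >>.
Proof. by rewrite bigcup_mkord. Qed.

Lemma canonical_filtration_preimage n i (B : set R) : (i < n)%N ->
  measurable B -> canonical_filtration X n (X i @^-1` B).
Proof.
move=> ltin mB; rewrite canonical_filtrationE; apply: sub_sigma_algebra.
by exists i => //; exists B => //; rewrite setTI.
Qed.

Lemma is_filtration_canonical : is_filtration (canonical_filtration X).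
Proof.
split=> [n|n|m n le_mn]; first exact: smallest_sigma_algebra.
- rewrite canonical_filtrationE.
  apply: smallest_sub; first exact: sigma_algebra_measurable.
  by move=> _ [i _ [B mB <-]]; exact: measurable_funP.
- rewrite (canonical_filtrationE m); apply: smallest_sub.
    exact: smallest_sigma_algebra.
  move=> _ [i /= ltim [B mB <-]]; rewrite setTI.
  by apply: canonical_filtration_preimage => //; exact: leq_trans le_mn.
Qed.

Lemma sub_canonical_filtration_cylinder n :
  canonical_filtration X n `<=` <<s cylinder n >>.
Proof.
rewrite canonical_filtrationE; apply: smallest_sub.
  exact: smallest_sigma_algebra.
move=> _ [i /= ltin [B mB <-]]; rewrite setTI; apply: sub_sigma_algebra.
(* A generator constrains one observation only; the other sides are [setT]. *)
exists (fun j => if j == i then B else setT).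
  by move=> j; case: ifP.
rewrite eqEsubset; split=> [w Bw j _|w]/=; first by case: eqP => // ->.
by move=> /(_ i ltin)/=; rewrite eqxx.
Qed.

Hypothesis indepX : mutually_independent P X.

Lemma mutually_independent_iota n (B : nat -> set R) :
  (forall i, measurable (B i)) ->
  P (\bigcap_(i in `I_n) (X i @^-1` B i)) =
  (\prod_(i < n) P (X i @^-1` B i))%E.
Proof.
move=> mB; have := @indepX [fset i in iota 0 n]%fset B (fun i _ => mB i).
rewrite (_ : [set` _] = `I_n); last first.
  by apply/seteqP; split=> i /=; rewrite inE/= mem_iota.
move=> ->; rewrite -(big_mkord xpredT (fun i => P (X i @^-1` B i))).
apply: perm_big; apply: uniq_perm; rewrite ?fset_uniq ?iota_uniq//.
by move=> i; rewrite inE/= /index_iota subn0.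
Qed.

(** Dynkin's argument: the events satisfying the product formula are stable under complements and
    countable disjoint unions, and they include the cylinders. *)
Lemma past_future_independent n (E : set T) (B : set R) :
  canonical_filtration X n E -> measurable B ->
  P (E `&` X n @^-1` B) = (P E * P (X n @^-1` B))%E.
Proof.
move=> FE mB; set D := X n @^-1` B.
have mD : measurable D by rewrite -[D]setTI; exact: measurable_funP.
have [_ Fm _] := is_filtration_canonical.
have cylm : <<s cylinder n >> `<=` @measurable _ T.
  apply: smallest_sub; first exact: sigma_algebra_measurable.
  move=> _ [C mC ->]; apply: bigcap_measurableType => // i _.
  by rewrite -[_ @^-1` _]setTI; exact: measurable_funP.
have indepC (S : set T) : measurable S ->
    P (S `&` D) = (P S * P D)%E -> P (~` S `&` D) = (P (~` S) * P D)%E.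
  move=> mS PS; rewrite setIC -setDE measureD//; last first.
    by rewrite (le_lt_trans (probability_le1 _ _)) ?ltry.
  rewrite [X in (_ - X)%E](_ : _ = P S * P D)%E; last by rewrite setIC.
  rewrite probability_setC//.
  by rewrite muleBl ?mul1e//; exact: fin_num_measure.
have indepU (F : (set T)^nat) : (forall i, measurable (F i)) ->
    trivIset setT F -> (forall i, P (F i `&` D) = (P (F i) * P D)%E) ->
    P (\bigcup_i F i `&` D) = (P (\bigcup_i F i) * P D)%E.
  move=> mF tF PF; rewrite setI_bigcupl measure_bigcup//; last 2 first.
  - by move=> i _; exact: measurableI.
  - exact: trivIset_setIr.
  rewrite measure_bigcup//.
  rewrite (@eq_eseriesr _ _ (fun i => P D * P (F i))%E); last first.
    by move=> i _; rewrite muleC; exact: PF.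
  rewrite -(fineK (fin_num_measure P D mD)) nneseriesZl//.
  by rewrite muleC.
apply: (@dynkin_induction _ (g_sigma_algebraType (cylinder n)) (cylinder n)
  [set E | P (E `&` D) = (P E * P D)%E]) => //=.
- move=> _ _ [C1 mC1 ->] [C2 mC2 ->].
  exists (fun i => C1 i `&` C2 i); first by move=> i; exact: measurableI.
  by rewrite -bigcapI.
- by rewrite setTI probability_setT mul1e.
- move=> _ [C mC ->] /=.
  (* Appending [B] as side [n] turns the cylinder intersected with [D] into a cylinder over [n.+1]
     observations. *)
  pose C' i := if i == n then B else C i.
  have mC' i : measurable (C' i) by rewrite /C'; case: ifP.
  have Cn : \bigcap_(i in `I_n) (X i @^-1` C i) =
            \bigcap_(i in `I_n) (X i @^-1` C' i).
    apply: eq_bigcapr => i /= ltin; rewrite /C' ifF//.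
    by apply/negbTE; rewrite neq_ltn ltin.
  rewrite Cn (_ : _ `&` D = \bigcap_(i in `I_n.+1) (X i @^-1` C' i)).
    rewrite !mutually_independent_iota// big_ord_recr/=.
    by rewrite {2}/C' eqxx.
  rewrite eqEsubset; split=> [w [Cw Dw] i /=|w Cw].
    rewrite ltnS leq_eqVlt => /predU1P[->|]; last exact: Cw.
    by rewrite /C' eqxx.
  split; first by move=> i /= ltin; apply: Cw => /=; rewrite ltnS ltnW.
  by have := Cw n (ltnSn n); rewrite /= /C' eqxx.
- by move=> S /cylm; exact: indepC.
- by move=> F mF; exact: (indepU F (fun i => cylm _ (mF i))).
- exact: sub_canonical_filtration_cylinder.
Qed.

End past_independence.

(** * Integrals of functions of two independent arguments *)

Section independent_integral.
Local Open Scope ereal_scope.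
Context (d d' : measure_display) (T : measurableType d) (U : measurableType d').
Context (R : realType) (P : probability T R) (G : set (set T)).
Variable Y : {mfun T >-> U}.
Hypotheses (sG : sigma_algebra setT G) (Gm : G `<=` measurable).
Hypothesis indepGY : forall E B, G E -> measurable B ->
  P (E `&` Y @^-1` B) = P E * P (Y @^-1` B).

Local Notation TG := (g_sigma_algebraType G).

Lemma g_sigma_algebra_measurableE : @measurable _ TG = G.
Proof. exact: sigma_algebra_id. Qed.

Lemma measurable_fun_sub_sigma_algebra (d0 : measure_display)
    (V : measurableType d0) (f : T -> V) :
  measurable_fun [set: TG] (f : TG -> V) -> measurable_fun [set: T] f.
Proof.
move=> mf _ B mB; apply: Gm; rewrite -g_sigma_algebra_measurableE.
exact: mf.
Qed.

(** By independence the law of the pair agrees with the product measure on rectangles, hence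
    everywhere; Tonelli then integrates [Y] out first. *)
Lemma ge0_integral_independent (f : TG * U -> \bar R) :
  measurable_fun setT f -> (forall z, 0 <= f z) ->
  \int[P]_w f (w, Y w) = \int[P]_w \int[distribution P Y]_y f (w, y).
Proof.
move=> mf f0.
have mid : measurable_fun [set: T] (id : T -> TG).
  exact: (@measurable_fun_sub_sigma_algebra _ TG).
(* The law of [i], the identity onto the coarser space, is the restriction of [P] to [G], so that
   rectangles involve only events to which [indepGY] applies. *)
pose i : {mfun T >-> TG} :=
  HB.pack (id : T -> TG) (isMeasurableFun.Build _ _ T TG id mid).
have mphi : measurable_fun [set: T] (fun w => (i w, Y w)).
  exact: measurable_fun_pair.
pose phi : {mfun T >-> (TG * U)%type} := HB.pack (fun w => (i w, Y w))
  (isMeasurableFun.Build _ _ T (TG * U)%type (fun w => (i w, Y w)) mphi).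
transitivity (\int[distribution P phi]_z f z).
  by rewrite ge0_integral_pushforward.
transitivity (\int[distribution P i \x distribution P Y]_z f z).
  apply: eq_measure_integral => A mA _; apply/esym.
  apply: product_measure_unique => // E B mE mB.
  have GE : G E by rewrite -g_sigma_algebra_measurableE.
  exact: (indepGY GE mB).
rewrite fubini_tonelli1// ge0_integral_pushforward//.
  exact: measurable_fun_fubini_tonelli_F.
by move=> w _; exact: integral_ge0.
Qed.

End independent_integral.

(** * Likelihood ratio of two normal laws *)

Section normal_likelihood_ratio.
Context (R : realType).
Implicit Types (m s mu sigma x : R).

(** The density of N(mu, sigma^2) over that of N(m, s^2), with the common factor in 2 pi
    cancelled. *)
Definition normal_lr m s mu sigma x : R :=
  s / sigma * expR ((x - m) ^+ 2 / (s ^+ 2 *+ 2) -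
                    (x - mu) ^+ 2 / (sigma ^+ 2 *+ 2)).

Lemma normal_lr_gt0 m s mu sigma x : 0 < s -> 0 < sigma ->
  0 < normal_lr m s mu sigma x.
Proof. by move=> s0 sigma0; rewrite mulr_gt0 ?expR_gt0// divr_gt0. Qed.

Lemma normal_lrE m s mu sigma x : 0 < s -> 0 < sigma ->
  normal_lr m s mu sigma x * normal_pdf m s x = normal_pdf mu sigma x.
Proof.
move=> s0 sigma0; rewrite !normal_pdfE ?gt_eqF//.
have peakE t : 0 < t -> normal_peak t = t^-1 * (Num.sqrt (pi *+ 2))^-1.
  move=> t0; rewrite /normal_peak -mulrnAr sqrtrM ?sqr_ge0// sqrtr_sqr.
  by rewrite gtr0_norm// invfM.
rewrite !peakE// /normal_lr /normal_fun expRD !mulNr !expRN.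
set c := (Num.sqrt _)^-1; set e1 := expR _; set e2 := expR _.
have e10 : e1 != 0 by rewrite gt_eqF// expR_gt0.
by field; rewrite e10 !gt_eqF// expR_gt0.
Qed.

Lemma measurable_normal_lr (d : measure_display) (T : measurableType d) m s
    (mu sigma x : T -> R) : (forall w, 0 < sigma w) ->
  measurable_fun setT mu -> measurable_fun setT sigma ->
  measurable_fun setT x ->
  measurable_fun setT (fun w => normal_lr m s (mu w) (sigma w) (x w)).
Proof.
move=> sigma0 mmu msigma mx.
have mV p : measurable_fun setT (fun w => (sigma w ^+ p)^-1).
  (* Inversion of a positive quantity is the power -1, which is measurable by [measurable_powR]. *)
  rewrite (_ : (fun w => _) = @powR R ^~ (-1) \o (fun w => sigma w ^+ p)).
    by apply: measurableT_comp; [exact: measurable_powR|exact: measurable_funX].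
  by apply/funext => w /=; rewrite powR_inv1// exprn_ge0// ltW.
rewrite /normal_lr; apply: measurable_funM.
  by apply: measurable_funM => //; exact: (mV 1%N).
apply: measurableT_comp => //; apply: measurable_funB.
  apply: measurable_funM => //.
  by apply: measurable_funX; exact: measurable_funB.
under eq_fun do rewrite -mulr_natr invfM.
apply: measurable_funM.
  by apply: measurable_funX; exact: measurable_funB.
by apply: measurable_funM => //; exact: (mV 2%N).
Qed.

(** Change of measure: the density of [Q] cancels the denominator and leaves the total mass of N(mu,
    sigma^2). *)
Lemma integral_normal_lr (Q : {measure set R -> \bar R}) m s mu sigma :
  (forall B : set R, measurable B -> Q B = normal_prob m s B) ->
  0 < s -> 0 < sigma -> (\int[Q]_x (normal_lr m s mu sigma x)%:E = 1)%E.
Proof.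
move=> QE s0 sigma0.
have mlr : measurable_fun [set: R] (EFin \o normal_lr m s mu sigma).
  by apply/measurable_EFinP; exact: measurable_normal_lr.
have lr0 x : (0 <= (normal_lr m s mu sigma x)%:E)%E.
  by rewrite lee_fin ltW// normal_lr_gt0.
(* [R] and [measurableTypeR R] carry the same sigma-algebra under different
   displays, hence the transfer along the identity. *)
have mid : measurable_fun [set: measurableTypeR R] (id : measurableTypeR R -> R).
  by move=> _ B mB; rewrite setTI.
pose i : {mfun measurableTypeR R >-> R} :=
  HB.pack (id : measurableTypeR R -> R) (isMeasurableFun.Build _ _ _ _ _ mid).
transitivity (\int[pushforward (normal_prob m s) i]_x
    (EFin \o normal_lr m s mu sigma) x)%E.
  by apply: eq_measure_integral => B mB _; exact: QE.
rewrite ge0_integral_pushforward//=.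
rewrite (@ge0_integral_density _ _ R lebesgue_measure (normal_prob m s)
  (normal_pdf m s))//=.
- rewrite -[RHS](integral_normal_pdf mu sigma).
  by apply: eq_integral => x _; rewrite -EFinM normal_lrE.
- exact: measurable_normal_pdf.
- by move=> x; exact: normal_pdf_ge0.
Qed.

End normal_likelihood_ratio.

(** * Wealth of all-or-nothing betting strategies, and upcrossings *)

Definition strategy_wealth (R : realType) (g : nat -> R) (H : nat -> bool)
    (n : nat) : R :=
  \prod_(i < n) (if H i then g i else 1).

Section upcrossing.
Context (R : realType).
Variables (g : nat -> R) (a b : R) (k : nat).
Hypotheses (g0 : forall n, 0 < g n) (a0 : 0 < a) (ab : a < b).

Let M n := \prod_(i < n) g i.

(* Number of completed half-upcrossings of [a, b], frozen at k.*2: it is odd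
   while waiting for M to exceed b, even while waiting for M to drop below a. *)
Fixpoint phase (M : nat -> R) (n : nat) : nat :=
  if n is n'.+1 then
    let p := phase M n' in
    (p + ((p < k.*2)%N && (if odd p then b < M n else M n < a)%R))%N
  else 0%N.

Lemma phase_le M' n : (phase M' n <= k.*2)%N.
Proof.
elim: n => //= n IH.
case: ltnP => [ltk|_]/=; rewrite ?addn0//.
by case: (if _ then _ else _) => /=; rewrite ?addn1 ?addn0.
Qed.

Lemma phase_homo M' : {homo phase M' : m n / (m <= n)%N}.
Proof.
by apply: homo_leq => // [m n p|n]; [exact: leq_trans|exact: leq_addr].
Qed.

(** By induction, each completed upcrossing multiplies the lower bound by [b / a]. During one, the
    wealth moves in proportion to [M], which was below [a] at entry, whence the factor [M n / a]. *)
Lemma strategy_wealth_upcrossing n :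
  (b / a) ^+ (phase M n)./2 * (if odd (phase M n) then M n / a else 1) <=
  strategy_wealth g (fun i => odd (phase M i)) n.
Proof.
rewrite /strategy_wealth; elim: n => [|n IH].
  by rewrite big_ord0/= expr0 mul1r.
have M0 i : 0 < M i by exact: prodr_gt0.
have ba0 i : 0 <= (b / a) ^+ i.
  by rewrite exprn_ge0// divr_ge0// ltW// (lt_trans a0).
rewrite big_ord_recr/=; have MS : M n.+1 = M n * g n by rewrite /M big_ord_recr.
set p := phase M n in IH *.
case: ifPn IH => [op|ep] IH.
  have {}IH : (b / a) ^+ p./2 * (M n.+1 / a) <=
     \prod_(i < n) (if odd (phase M i) then g i else 1) * g n.
    by rewrite MS (mulrAC (M n)) mulrA ler_pM2r.
  have [/andP[_ bM]|_] := boolP ((p < k.*2)%N && _); last by rewrite addn0 op.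
  apply: le_trans IH.
  rewrite addn1/= op/= mulr1 uphalf_half op add1n exprSr.
  by apply: ler_wpM2l => //; rewrite ler_pM2r ?invr_gt0// ltW.
rewrite mulr1.
have [/andP[_ Ma]|_] := boolP ((p < k.*2)%N && _); last first.
  by rewrite addn0 (negbTE ep).
apply: le_trans IH.
rewrite addn1/= ep uphalf_half (negbTE ep) add0n.
by apply: ler_wpM2l => //; rewrite ler_pdivrMr// mul1r ltW.
Qed.

Lemma phase_reaches : (forall n, exists2 m, (n <= m)%N & M m < a) ->
  (forall n, exists2 m, (n <= m)%N & b < M m) -> exists n, phase M n = k.*2.
Proof.
move=> lowM highM.
suff reach p : (p <= k.*2)%N -> exists n, (p <= phase M n)%N.
  have [n kn] := reach _ (leqnn _); exists n; apply/eqP.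
  by rewrite eqn_leq kn phase_le.
elim: p => [|p IH] pk; first by exists 0%N.
have [n pn] := IH (ltnW pk).
(* Asking for [n.+1 <= m] makes [m] a successor: at its predecessor the phase is at least [p], and
   if it equals [p] it advances at [m]. *)
have [m nm Mm] : exists2 m, (n.+1 <= m)%N & if odd p then b < M m else M m < a.
  by case: (odd p).
exists m; case: m nm Mm => // m nm Mm.
have := leq_trans pn (@phase_homo M n m nm).
rewrite leq_eqVlt => /predU1P[pE|pm]; last first.
  exact: leq_trans pm (@phase_homo M m m.+1 _).
by rewrite /= -pE Mm pk addn1.
Qed.

End upcrossing.

(** * Lower and upper limits of extended real sequences *)

Section limn_einf_bounds.
Local Open Scope ereal_scope.
Context (R : realType).
Implicit Types (u : (\bar R)^nat) (l : \bar R).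

Lemma le_limn_einf u l n0 : (forall n, (n0 <= n)%N -> l <= u n) ->
  l <= limn_einf u.
Proof.
move=> lu; rewrite limn_einf_lim; apply: lime_ge; first exact: is_cvg_einfs.
near=> n; apply: le_ereal_inf_tmp => _ [m /= nm <-]; apply: lu.
by apply: leq_trans nm; near: n; exact: nbhs_infty_ge.
Unshelve. all: by end_near. Qed.

Lemma limn_einf_le u l : (forall n, u n <= l) -> limn_einf u <= l.
Proof.
move=> ul; rewrite limn_einf_lim; apply: lime_le; first exact: is_cvg_einfs.
apply: nearW => n; apply: le_trans (ul n).
by apply: ereal_inf_lbound; exists n => /=.
Qed.

Lemma le_limn_esup u v : (forall n, u n <= v n) -> limn_esup u <= limn_esup v.
Proof.
move=> uv; rewrite !limn_esup_lim.
apply: lee_lim; [exact: is_cvg_esups|exact: is_cvg_esups|].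
apply: nearW => n; apply: ge_ereal_sup => _ [m /= nm <-].
by apply: le_trans (uv m) _; apply: ereal_sup_ubound; exists m.
Qed.

Lemma limn_esup_gt u l : l < limn_esup u ->
  forall n, exists2 m, (n <= m)%N & l < u m.
Proof.
move=> lu n; have : l < esups u n.
  apply: lt_le_trans lu _; rewrite limn_esup_lim.
  apply: lime_le; first exact: is_cvg_esups.
  near=> m; apply: nonincreasing_esups.
  by near: m; exact: nbhs_infty_ge.
by move=> /ereal_sup_gt[_ [m /= nm <-]] lum; exists m.
Unshelve. all: by end_near. Qed.

Lemma limn_einf_lt u l : limn_einf u < l ->
  forall n, exists2 m, (n <= m)%N & u m < l.
Proof.
(* [limn_einf] is the opposite of the [limn_esup] of the opposite sequence. *)
rewrite -lteN2 oppeK => lu n.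
have [m nm] := limn_esup_gt lu n.
by rewrite lteN2; exists m.
Qed.

(** Reduces oscillation to countably many intervals, with a positive left endpoint so that the ratio
    of the endpoints makes sense. *)
Lemma ge0_rat_between (x y : \bar R) : 0 <= x -> x < y ->
  exists p q : rat, [/\ (0 < ratr p :> R)%R, (ratr p < ratr q :> R)%R,
    x < (ratr p)%:E & (ratr q)%:E < y].
Proof.
move=> x0 xy; have [r rx] : exists r, x = r%:E.
  case: x x0 xy => [r _ _|_|]; [by exists r| |by rewrite leNgt ltNy0].
  by rewrite ltNge leey.
(* [t] is [y] itself when [y] is finite, and [r + 1] when it is infinite. *)
have [t rt ty] : exists2 t, (r < t)%R & t%:E <= y.
  rewrite rx in xy; case: y xy => [t|_|]; last by rewrite ltNge leNye.
    by rewrite lte_fin; exists t.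
  by exists (r + 1)%R; [rewrite ltrDl|exact: leey].
have [p] := rat_in_itvoo rt; rewrite in_itv/= => /andP[rp pt].
have [q] := rat_in_itvoo pt; rewrite in_itv/= => /andP[pq qt].
exists p, q; split => //.
- by apply: le_lt_trans rp; rewrite -lee_fin -rx.
- by rewrite rx lte_fin.
- by apply: lt_le_trans ty; rewrite lte_fin.
Qed.

End limn_einf_bounds.

(** * Comparison of integrals under almost sure domination *)

Section integral_majorant.
Local Open Scope ereal_scope.
Context (d : measure_display) (T : measurableType d) (R : realType).
Variable mu : {measure set T -> \bar R}.

Import HBNNSimple.

(* Unlike [ge0_le_integral], no measurability is required. *)
Lemma ge0_le_integralT (f1 f2 : T -> \bar R) : (forall x, 0 <= f1 x) ->
  (forall x, f1 x <= f2 x) -> \int[mu]_x f1 x <= \int[mu]_x f2 x.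
Proof.
move=> f10 f12; rewrite !ge0_integralTE//; last first.
  by move=> x; exact: le_trans (f12 x).
apply: ereal_sup_le => _ [h /= hf1 <-].
by exists h => // x; exact: le_trans (f12 x).
Qed.

(** Raising [f2] to [+oo] on a null set keeps its integral and makes the domination hold everywhere.
    The role of [f1] will be played by the stopped process. *)
Lemma ae_majorant_integral (f1 f2 : T -> \bar R) (N : set T) :
  mu.-negligible N -> measurable_fun setT f2 -> (forall x, 0 <= f1 x) ->
  (forall x, 0 <= f2 x) -> (forall x, ~ N x -> f1 x <= f2 x) ->
  \int[mu]_x f1 x <= \int[mu]_x f2 x.
Proof.
move=> [N' [mN' muN' NN']] mf2 f10 f20 f12.
pose f3 x := if x \in N' then +oo else f2 x.
have f30 x : 0 <= f3 x by rewrite /f3; case: ifP => // _; exact: leey.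
have mf3 : measurable_fun setT f3.
  apply: measurable_fun_ifT => //; apply: (measurable_fun_bool true).
  rewrite setTI (_ : _ @^-1` _ = N')//.
  by apply/seteqP; split=> x /=; [move/set_mem|move/mem_set].
have -> : \int[mu]_x f2 x = \int[mu]_x f3 x.
  apply: ge0_ae_eq_integral => //; exists N'; split => // x.
  by apply: contra_notP => N'x _; rewrite /f3 memNset.
apply: ge0_le_integralT => // x; rewrite /f3; case: ifPn => [_|].
  exact: leey.
by rewrite notin_setE => N'x; apply: f12 => /NN'.
Qed.

End integral_majorant.

(** * Optional stopping for positive multiplicative supermartingales *)

Section stopped_martingale.
Context (d : measure_display) (T : measurableType d) (R : realType).
Variables (P : probability T R) (F : nat -> set (set T)) (g : nat -> T -> R).

Local Notation TF n := (g_sigma_algebraType (F n)).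

Hypotheses (filF : is_filtration F) (g0 : forall n w, 0 < g n w).
Hypothesis mg : forall n, measurable_fun [set: TF n.+1] (g n).
(** The supermartingale property, that [g n] has conditional mean at most 1 given [F n], in a form
    free of conditional expectations. *)
Hypothesis intg : forall n (A : T -> R), measurable_fun [set: TF n] A ->
  (forall w, 0 <= A w) ->
  (\int[P]_w (A w * g n w)%:E <= \int[P]_w (A w)%:E)%E.

Let M n w := \prod_(i < n) g i w.

Lemma measurable_filtrationE n : @measurable _ (TF n) = F n.
Proof. by have [sF _ _] := filF; exact: g_sigma_algebra_measurableE. Qed.

Lemma measurable_fun_filtration (d' : measure_display) (U : measurableType d')
    m n (f : T -> U) : (m <= n)%N ->
  measurable_fun [set: TF m] f -> measurable_fun [set: TF n] f.
Proof.
have [_ _ homoF] := filF.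
move=> mn mf _ B mB; rewrite measurable_filtrationE; apply: (homoF _ _ mn).
by rewrite -measurable_filtrationE; exact: mf.
Qed.

Lemma measurable_fun_filtrationT (d' : measure_display) (U : measurableType d')
    n (f : T -> U) : measurable_fun [set: TF n] f -> measurable_fun [set: T] f.
Proof.
by have [sF Fm _] := filF; exact: measurable_fun_sub_sigma_algebra.
Qed.

Section wealth.
Variable H : nat -> T -> bool.
Hypothesis mH : forall n, measurable_fun [set: TF n] (H n).

Let W n w := strategy_wealth (g^~ w) (H^~ w) n.

Let WS n w : W n.+1 w = W n w * (if H n w then g n w else 1).
Proof. by rewrite /W /strategy_wealth big_ord_recr. Qed.

Lemma strategy_wealth_ge0 n w : 0 <= W n w.
Proof. by apply: prodr_ge0 => i _; case: ifP => // _; rewrite ltW. Qed.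

Lemma measurable_strategy_wealth n : measurable_fun [set: TF n] (W n).
Proof.
elim: n => [|n IH].
  rewrite (_ : W 0 = cst 1)//; apply/funext => w.
  by rewrite /W /strategy_wealth big_ord0.
rewrite (_ : W n.+1 = fun w => W n w * (if H n w then g n w else 1)).
  apply: measurable_funM; first exact: measurable_fun_filtration IH.
  apply: measurable_fun_ifT; [|exact: mg|exact: measurable_cst].
  exact: measurable_fun_filtration (leqnSn n) (@mH n).
by apply/funext.
Qed.

Let measurable_wealthT n : measurable_fun [set: T] (W n).
Proof. exact: (measurable_fun_filtrationT (@measurable_strategy_wealth n)). Qed.

(** The wealth splits into a staked part [A] and an idle part [B], both known at time [n]; [intg]
    bounds the staked part after the bet. *)
Lemma integral_strategy_wealth n : (\int[P]_w (W n w)%:E <= 1)%E.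
Proof.
elim: n => [|n IH].
  rewrite (eq_integral (cst 1%E)).
    by rewrite integral_cst//= mul1e probability_le1.
  by move=> w _; rewrite /W /strategy_wealth big_ord0.
apply: le_trans IH.
pose A w := if H n w then W n w else 0.
pose B w := if H n w then 0 else W n w.
have A0 w : 0 <= A w.
  by rewrite /A; case: ifP => // _; exact: strategy_wealth_ge0.
have B0 w : 0 <= B w.
  by rewrite /B; case: ifP => // _; exact: strategy_wealth_ge0.
have mA : measurable_fun [set: TF n] A.
  by apply: measurable_fun_ifT => //; exact: measurable_strategy_wealth.
have mB : measurable_fun [set: TF n] B.
  by apply: measurable_fun_ifT => //; exact: measurable_strategy_wealth.
have mA' := measurable_fun_filtrationT mA.
have mB' := measurable_fun_filtrationT mB.
have mg' := measurable_fun_filtrationT (@mg n).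
rewrite [leLHS](_ : _ = \int[P]_w ((A w * g n w)%:E + (B w)%:E))%E; last first.
  apply: eq_integral => w _; rewrite WS /A /B -EFinD.
  by case: ifP => _; rewrite ?addr0 ?mul0r ?add0r ?mulr1.
rewrite [leRHS](_ : _ = \int[P]_w ((A w)%:E + (B w)%:E))%E; last first.
  apply: eq_integral => w _; rewrite /A /B -EFinD.
  by case: ifP => _; rewrite ?addr0 ?add0r.
rewrite !ge0_integralD//; first by rewrite leeD2r// intg.
- by move=> w _; rewrite lee_fin.
- exact/measurable_EFinP.
- by move=> w _; rewrite lee_fin.
- exact/measurable_EFinP.
- by move=> w _; rewrite lee_fin mulr_ge0// ltW.
- by apply/measurable_EFinP; exact: measurable_funM.
- by move=> w _; rewrite lee_fin.
- exact/measurable_EFinP.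
Qed.

Lemma measurable_limn_einf_wealth :
  measurable_fun [set: T] (fun w => limn_einf (fun n => (W n w)%:E)).
Proof.
apply: measurableT_comp => //.
apply: (measurable_fun_limn_esup (f := fun n w => (- (W n w)%:E)%E)) => n.
by apply/measurable_EFinP; exact: measurableT_comp.
Qed.

Lemma integral_limn_einf_wealth :
  (\int[P]_w limn_einf (fun n => (W n w)%:E) <= 1)%E.
Proof.
have := @fatou _ _ _ P setT measurableT (fun n w => (W n w)%:E).
move=> /(_ _ _)/le_trans; apply.
- by move=> n; apply/measurable_EFinP; exact: measurable_wealthT.
- by move=> n w _; rewrite lee_fin strategy_wealth_ge0.
- by apply: limn_einf_le => n; exact: integral_strategy_wealth.
Qed.

End wealth.

(** [M] is the wealth of the strategy that always bets. *)
Lemma measurable_partial_product n : measurable_fun [set: TF n] (M n).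
Proof. exact: (@measurable_strategy_wealth (fun _ _ => true)). Qed.

(** The phase at [n] looks at [M] up to time [n] only, so its parity may decide the bet on [g n]. *)
Lemma measurable_phase a b k n :
  measurable_fun [set: TF n] (fun w => phase a b k (M^~ w) n).
Proof.
elim: n => [|n IH]; first exact: measurable_cst.
have mp (d' : measure_display) (U : measurableType d') (h : nat -> U) :
    measurable_fun [set: TF n.+1] (fun w => h (phase a b k (M^~ w) n)).
  apply: (@measurableT_comp _ _ _ _ _ _ h); first by move=> _ B _.
  exact: measurable_fun_filtration IH.
have mM := @measurable_partial_product n.+1.
pose c w := (phase a b k (M^~ w) n < k.*2)%N &&
  (if odd (phase a b k (M^~ w) n) then b < M n.+1 w else M n.+1 w < a).
have mc : measurable_fun [set: TF n.+1] c.
  apply: measurable_and; first exact: (mp _ _ (fun p => p < k.*2)%N).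
  apply: measurable_fun_ifT; first exact: (mp _ _ odd).
    exact: measurable_fun_ltr.
  exact: measurable_fun_ltr.
rewrite (_ : (fun w => _) = fun w =>
    if c w then (phase a b k (M^~ w) n).+1 else phase a b k (M^~ w) n).
  by apply: measurable_fun_ifT; [exact: mc|exact: (mp _ _ S)|exact: (mp _ _ id)].
by apply/funext => w /=; rewrite -/(c w); case: (c w); rewrite ?addn1 ?addn0.
Qed.


(* Dubins' inequality: investing everything in M at each fall below a and
   withdrawing at each rise above b multiplies the wealth by b / a at every
   upcrossing, while its expectation stays at most 1. *)
Lemma oscillation_negligible a b : 0 < a -> a < b ->
  P.-negligible [set w | (forall n, exists2 m, (n <= m)%N & M m w < a) /\
                         (forall n, exists2 m, (n <= m)%N & b < M m w)].
Proof.
move=> a0 ab; set r := b / a.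
have r1 : 1 < r by rewrite ltr_pdivlMr// mul1r.
have r0 : 0 < r by exact: lt_trans r1.
pose H k i w := odd (phase a b k (M^~ w) i).
have mH k i : measurable_fun [set: TF i] (H k i).
  apply: (@measurableT_comp _ _ _ _ _ _ odd); first by move=> _ B _.
  exact: measurable_phase.
pose L k w := limn_einf (fun n => (strategy_wealth (g^~ w) (H k ^~ w) n)%:E).
have mL k : measurable_fun [set: T] (L k).
  exact: measurable_limn_einf_wealth.
have L0 k w : (0 <= L k w)%E.
  by apply: (le_limn_einf (n0 := 0%N)) => n _; rewrite lee_fin strategy_wealth_ge0.
pose D k := [set w | ((r ^+ k)%:E <= L k w)%E].
have mD k : measurable (D k).
  by rewrite -[D k]setTI; exact: emeasurable_fun_c_infty.
(* Markov's inequality for [L k], whose integral is at most 1. *)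
have PD k : (P (D k) <= (r ^- k)%:E)%E.
  have rk0 : 0 < r ^+ k by exact: exprn_gt0.
  rewrite -(@lee_pmul2l _ (r ^+ k)%:E) ?lte_fin// -EFinM divff ?gt_eqF//.
  have -> : ((r ^+ k)%:E * P (D k) = \int[P]_(w in D k) (cst (r ^+ k)%:E) w)%E.
    by rewrite integral_cst.
  apply: (@le_trans _ _ (\int[P]_(w in D k) L k w)%E).
    apply: ge0_le_integral => //; first by move=> w _; rewrite lee_fin ltW.
    exact: measurable_funTS.
  apply: (@le_trans _ _ (\int[P]_w L k w)%E); last first.
    exact: integral_limn_einf_wealth.
  exact: ge0_subset_integral.
(* An oscillating path completes [k] upcrossings for every [k], hence lies in every [D k]; as
   [r > 1], the bounds [r ^- k] tend to 0. *)
exists (\bigcap_k D k); split; first exact: bigcapT_measurable.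
  apply/eqP; rewrite eq_le measure_ge0 andbT.
  apply/lee_addgt0Pr => e e0; rewrite add0e.
  have [k rke] : exists k, r ^- k < e.
    have : (r^-1) ^+ n @[n --> \oo] --> (0 : R).
      by apply: cvg_expr; rewrite gtr0_norm ?invr_gt0// invf_lt1.
    move=> /cvgrPdist_lt/(_ _ e0)[k _ /(_ k (leqnn k))].
    rewrite sub0r normrN ger0_norm ?exprn_ge0 ?invr_ge0 ?ltW// exprVn => ke.
    by exists k.
  apply: (@le_trans _ _ (P (D k))).
    apply: le_measure; rewrite ?inE//; first exact: bigcapT_measurable.
    exact: bigcap_inf.
  by apply: le_trans (PD k) _; rewrite lee_fin ltW.
move=> w [lowM highM] k _ /=.
(* From [n0] on the phase is frozen at [k.*2], so the wealth stays at least [r ^+ k], and so does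
   its lower limit. *)
have [n0 n0E] := @phase_reaches R (g^~ w) a b k lowM highM.
apply: (le_limn_einf (n0 := n0)) => n n0n; rewrite lee_fin.
have := strategy_wealth_upcrossing k (g0^~ w) a0 ab n.
have -> : phase a b k (fun i => \prod_(j < i) g j w) n = k.*2.
  apply/eqP; rewrite eqn_leq phase_le/= -{1}n0E; exact: phase_homo.
by rewrite odd_double doubleK mulr1.
Qed.

(** A gap between the two limits contains a rational interval across which [M] oscillates forever,
    and each such interval contributes a negligible set. *)
Lemma limn_esup_le_einf_ae : exists2 N, P.-negligible N &
  forall w, ~ N w ->
  (limn_esup (fun n => (M n w)%:E) <= limn_einf (fun n => (M n w)%:E))%E.
Proof.
pose O (q : rat * rat) :=
  if (0 < ratr q.1 :> R) && (ratr q.1 < ratr q.2 :> R) then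
    [set w | (forall n, exists2 m, (n <= m)%N & M m w < ratr q.1) /\
             (forall n, exists2 m, (n <= m)%N & ratr q.2 < M m w)]
  else set0.
(* Pairs of rationals are enumerated by their codes; an integer coding no pair contributes
   [set0]. *)
exists (\bigcup_n (if (choice.unpickle n : option (rat * rat)) is Some q
                   then O q else set0)).
  apply: negligible_bigcup => n; case: choice.unpickle => [q|]; last first.
    exact: negligible_set0.
  rewrite /O; case: ifPn => [/andP[q0 q12]|_]; last exact: negligible_set0.
  exact: oscillation_negligible.
move=> w Nw; rewrite leNgt; apply/negP => lt_inf_sup.
have inf0 : (0 <= limn_einf (fun n => (M n w)%:E))%E.
  apply: (le_limn_einf (n0 := 0%N)) => n _; rewrite lee_fin.
  by apply: prodr_ge0 => i _; rewrite ltW.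
have [p [q [p0 pq infp qsup]]] := ge0_rat_between inf0 lt_inf_sup.
apply: Nw; exists (choice.pickle (p, q)); [by []|rewrite choice.pickleK /O p0 pq].
by split=> n; [have [m nm mp] := limn_einf_lt infp n
              |have [m nm mp] := limn_esup_gt qsup n];
  exists m; rewrite // -lte_fin.
Qed.

(** The lower limit of the wealth obtained by betting until [tau] dominates the stopped process
    almost surely: it is [M k] if [tau] is [k], and the lower limit of [M] if [tau] is infinite. *)
Lemma integral_stopped_le1 (Z : nat -> T -> \bar R) tau :
  (forall n w, 0 <= Z n w <= (M n w)%:E)%E -> stopping_time F tau ->
  (\int[P]_w stopped Z tau w <= 1)%E.
Proof.
move=> ZM tauF.
have [N Nneg NM] := limn_esup_le_einf_ae.
(* With a strict inequality, stopping at [k] collects exactly the factors of index below [k]; no bet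
   is placed at [i] precisely when [tau] is at most [i], an event of [F i]. *)
pose H i w := if tau w is Some k then (i < k)%N else true.
have mH i : measurable_fun [set: TF i] (H i).
  apply: (measurable_fun_bool false); rewrite setTI measurable_filtrationE.
  rewrite (_ : _ @^-1` _ = [set w | exists2 k, tau w = Some k & (k <= i)%N]).
    exact: tauF.
  apply/seteqP; split=> w; rewrite /H /=.
    by case: (tau w) => // k /negbT; rewrite -leqNgt => ki; exists k.
  by move=> [k -> ki]; apply/negbTE; rewrite -leqNgt.
apply: le_trans (integral_limn_einf_wealth mH).
have stopped_ge0 w : (0 <= stopped Z tau w)%E.
  rewrite /stopped; case: (tau w) => [k|]; first by have /andP[] := ZM k w.
  apply: (@le_trans _ _ (limn_einf (fun n => Z n w))).
    by apply: (le_limn_einf (n0 := 0%N)) => n _; have /andP[] := ZM n w.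
  exact: limn_einf_sup.
apply: (ae_majorant_integral Nneg) => //.
- exact: measurable_limn_einf_wealth.
- move=> w; apply: (le_limn_einf (n0 := 0%N)) => n _.
  by rewrite lee_fin strategy_wealth_ge0.
move=> w /NM Mw; rewrite /stopped /strategy_wealth /H; case: (tau w) => [k|].
  apply: (le_limn_einf (n0 := k)) => n kn; have /andP[_] := ZM k w.
  by rewrite /M (big_ord_widen n (fun i => g i w) kn) big_mkcond.
apply: le_trans Mw; apply: le_limn_esup => n.
by have /andP[] := ZM n w.
Qed.


End stopped_martingale.

(** * Domination and measurability of [Rminus] *)

Section Rminus_theory.
Context (R : realType) (d : measure_display) (T : measurableType d).
Variables (X : nat -> {mfun T >-> R}) (mu sigma : nat -> T -> R).
Hypothesis sigma_gt0 : forall n w, 0 < sigma n w.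

Lemma Rminus_ge0 n w : 0 <= Rminus X mu sigma n w.
Proof.
case: n => [|n] //=; rewrite !mulr_ge0 ?powR_ge0 ?expR_ge0//.
by apply: prodr_ge0 => i _; rewrite mulr_ge0 ?expR_ge0// invr_ge0 ltW.
Qed.

(* The factor in front of the product is the inverse of the normal likelihood
   maximised over m <= 0 and s > 0 (up to the power of 2 pi). *)
Lemma Rminus_le_lr m s n w : m <= 0 -> 0 < s ->
  Rminus X mu sigma n w <=
  \prod_(i < n) normal_lr m s (mu i w) (sigma i w) (X i w).
Proof.
move=> m0 s0; case: n => [|n]; first by rewrite big_ord0.
(* The factors involving the estimators are common to both sides; only the inverse likelihood at [m]
   and [s] remains to be compared. *)
rewrite [X in _ <= X](_ : _ = (\prod_(i < n.+1) (s *
      expR ((X i w - m) ^+ 2 / (s ^+ 2 *+ 2)))) *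
    \prod_(i < n.+1) ((sigma i w)^-1 *
      expR (- 2^-1 * ((X i w - mu i w) / sigma i w) ^+ 2))); last first.
  rewrite -big_split/=; apply: eq_bigr => i _.
  rewrite /normal_lr expRD mulrACA; congr (_ * (_ * expR _)).
  by field; rewrite gt_eqF.
apply: ler_wpM2r.
  by apply: prodr_ge0 => i _; rewrite mulr_ge0 ?expR_ge0// invr_ge0 ltW.
rewrite big_split/= prodr_const card_ord -expR_sum.
have [V0 VS] := profile_variance_le (fun i => X i w) m0 (ltn0Sn n).
apply: le_trans (profile_le n.+1 s0 V0) _.
rewrite ler_pM2l ?exprn_gt0// ler_expR -mulr_suml.
rewrite -[s ^+ 2 *+ 2]mulr_natl.
by rewrite ler_pM2r// invr_gt0 mulr_gt0// exprn_gt0.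
Qed.

Local Notation F := (canonical_filtration X).
Local Notation TF n := (g_sigma_algebraType (F n)).

Lemma measurable_adapted (d' : measure_display) (U : measurableType d')
    (Y : nat -> T -> U) n : adapted F Y -> measurable_fun [set: TF n] (Y n).
Proof.
move=> aY _ B mB; rewrite setTI.
by rewrite (measurable_filtrationE (is_filtration_canonical X)); exact: aY.
Qed.

Lemma measurable_observation i n : (i < n)%N -> measurable_fun [set: TF n] (X i).
Proof.
move=> ltin _ B mB; rewrite setTI.
rewrite (measurable_filtrationE (is_filtration_canonical X)).
exact: canonical_filtration_preimage.
Qed.

Hypothesis mu_adapted : adapted F mu.
Hypothesis sigma_adapted : adapted F sigma.

Lemma measurable_past_normal_lr m s i n : (i < n)%N -> measurable_fun [set: TF n]
  (fun w => normal_lr m s (mu i w) (sigma i w) (X i w)).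
Proof.
move=> ltin; have mF (Y : nat -> T -> R) : adapted F Y ->
    measurable_fun [set: TF n] (Y i).
  move=> /(measurable_adapted (n := i)).
  by apply: (measurable_fun_filtration (is_filtration_canonical X)); exact: ltnW.
apply: measurable_normal_lr => //; [exact: mF|exact: mF|].
exact: measurable_observation.
Qed.

Lemma measurable_Rminus n : measurable_fun [set: TF n] (Rminus X mu sigma n).
Proof.
case: n => [|n]; first exact: measurable_cst.
have mX (i : 'I_n.+1) : measurable_fun [set: TF n.+1] (X i).
  exact: measurable_observation.
apply: measurable_funM; first apply: measurable_funM => //.
  apply: (@measurableT_comp _ _ _ _ _ _ (@powR R ^~ (n.+1%:R / 2))).
    exact: measurable_powR.
  apply: measurable_funB.
    apply: measurable_funM => //; apply: measurable_sum => i.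
    exact: measurable_funX.
  apply: measurable_funX; apply: measurable_minr => //.
  by apply: measurable_funM => //; exact: measurable_sum.
apply: measurable_prod => i _.
(* Each factor is a likelihood ratio against N(0, 1), corrected by the exponential of that law, so
   the measurability of [normal_lr] can be reused. *)
rewrite (_ : (fun w => _) = fun w => normal_lr 0 1 (mu i w) (sigma i w) (X i w) *
    expR (- (X i w ^+ 2 / 2))).
  apply: measurable_funM; first exact: measurable_past_normal_lr.
  apply: measurableT_comp => //; apply: measurableT_comp => //.
  by apply: measurable_funM => //; exact: measurable_funX.
apply/funext => w; rewrite /normal_lr div1r -mulrA -expRD; congr (_ * expR _).
by field; rewrite gt_eqF.
Qed.

(** With the past frozen, [mu n] and [sigma n] are constants and the integral of the ratio over the
    next observation is 1. *)
Lemma integral_past_normal_lr (P : probability T R) (Q : probability R R) m s n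
    (A : T -> R) : 0 < s ->
  (forall B : set R, measurable B -> Q B = normal_prob m s B) ->
  iid_from Q P X -> measurable_fun [set: TF n] A -> (forall w, 0 <= A w) ->
  (\int[P]_w (A w * normal_lr m s (mu n w) (sigma n w) (X n w))%:E =
   \int[P]_w (A w)%:E)%E.
Proof.
move=> s0 QE [indepX lawX] mA A0.
have [sF Fm _] := is_filtration_canonical X.
(* The first coordinate carries the past, the second the new observation. *)
pose f (z : TF n * R) :=
  (A z.1 * normal_lr m s (mu n z.1) (sigma n z.1) z.2)%:E.
have mf : measurable_fun setT f.
  apply/measurable_EFinP; apply: measurable_funM.
    exact: (measurableT_comp mA).
  apply: measurable_normal_lr => //.
  - exact: (measurableT_comp (measurable_adapted (n := n) mu_adapted)).
  - exact: (measurableT_comp (measurable_adapted (n := n) sigma_adapted)).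
have lr0 w x : 0 <= normal_lr m s (mu n w) (sigma n w) x.
  by rewrite ltW// normal_lr_gt0.
transitivity (\int[P]_w f (w, X n w))%E => //.
rewrite (@ge0_integral_independent _ _ _ _ _ P (F n) (X n))//.
- apply: eq_integral => w _; rewrite /f/=.
  under eq_integral do rewrite EFinM.
  rewrite ge0_integralZl ?lee_fin//.
  + rewrite (@integral_normal_lr _ _ m s) ?mule1// => B mB.
    by rewrite -QE//; exact: lawX.
  + by apply/measurable_EFinP; exact: measurable_normal_lr.
  + by move=> x _; rewrite lee_fin.
- by move=> E B FE mB; exact: past_future_independent.
- by move=> z; rewrite lee_fin mulr_ge0.
Qed.

End Rminus_theory.

Theorem theorem3p4 (R : realType) (d : measure_display) (T : measurableType d)
    (X : nat -> {mfun T >-> R}) (mu sigma : nat -> T -> R)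
    (mu_adapted : adapted (canonical_filtration X) mu)
    (sigma_adapted : adapted (canonical_filtration X) sigma)
    (sigma_gt0 : forall n w, 0 < sigma n w) :
  is_eprocess X (@normal_nonpos_mean R) (canonical_filtration X)
    (fun n w => (Rminus X mu sigma n w)%:E).
Proof.
have filF := is_filtration_canonical X.
split=> //.
- move=> n B mB; rewrite -(measurable_filtrationE filF) -[_ @^-1` _]setTI.
  suff /measurable_EFinP : measurable_fun
    [set: g_sigma_algebraType (canonical_filtration X n)] (Rminus X mu sigma n).
    exact.
  exact: measurable_Rminus.
- by move=> n w; rewrite lee_fin Rminus_ge0.
- move=> tau tauF Q [m [s [m0 s0 QE]]] P iidX.
  (* The reference law is [Q] itself, so each member of the null hypothesis gets its own dominating
     product. *)
  apply: (@integral_stopped_le1 _ _ _ P (canonical_filtration X)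
    (fun i w => normal_lr m s (mu i w) (sigma i w) (X i w))) => //.
  + by move=> n w; exact: normal_lr_gt0.
  + by move=> n; exact: measurable_past_normal_lr.
  + by move=> n A mA A0; rewrite (integral_past_normal_lr _ _ _ _ QE).
  + by move=> n w; rewrite !lee_fin Rminus_ge0// Rminus_le_lr.
Qed.
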